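(* Let $\Gamma$ be a discrete group, $n\ge1$, and let $a\in H^n(\mathrm{B}\Gamma;\mathbf{R})$. Then $a$ is hyperbolic if and only if $a$ has a 1-bounded representative.
   Context: $\mathrm{E}\Gamma$ is the standard simplicial model: its $n$-simplices are the $(n+1)$-tuples $(g_0,\dots,g_n)$ of elements of $\Gamma$, with $\Gamma$ acting by $(g_0,\dots,g_n)\mapsto(g_0g,\dots,g_ng)$, and $\mathrm{B}\Gamma=\mathrm{E}\Gamma/\Gamma$ with quotient map $p$. Cochains $C^n(\mathrm{E}\Gamma;\mathbf{R})$ are functions $\Gamma^{n+1}\to\mathbf{R}$ with $\delta\omega(g_0,\dots,g_{n+1})=\sum_{i}(-1)^i\omega(g_0,\dots,\widehat{g_i},\dots,g_{n+1})$, and $\Gamma$ acts by $(g\omega)(g_0,\dots,g_n)=\omega(g_0g,\dots,g_ng)$. Cochains on $\mathrm{B}\Gamma$ are identified via $p^*$ with $\Gamma$-invariant (''homogeneous'') cochains on $\mathrm{E}\Gamma$. Hyperbolic: a cochain $\alpha\in C^k(\mathrm{E}\Gamma;\mathbf{R})$ is tamed by $\nu\in C^k(\mathrm{E}\Gamma;\mathbf{R})$ if $|(g\alpha-\alpha)(\triangle)|\le\nu(\triangle)$ for all $g\in\Gamma$ and all $k$-simplices $\triangle$. A cocycle $\alpha\in C^n(\mathrm{B}\Gamma;\mathbf{R})$ is hyperbolic if $p^*\alpha=\delta\beta$ for some $\beta\in C^{n-1}(\mathrm{E}\Gamma;\mathbf{R})$ tamed by a $\Gamma$-invariant cochain (one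 lifted from $\mathrm{B}\Gamma$). A class in $H^n(\mathrm{B}\Gamma;\mathbf{R})$ is hyperbolic if it has a hyperbolic representative. 1-bounded: a homogeneous cochain $\omega\in C^n(\mathrm{E}\Gamma;\mathbf{R})^\Gamma$ is 1-bounded if there is a homogeneous $(n-1)$-cochain $\lambda$ with $|\omega(h,g_1,\dots,g_n)-\omega(1,g_1,\dots,g_n)|<\lambda(g_1,\dots,g_n)$ for all $h,g_1,\dots,g_n\in\Gamma$. (Equivalently, the corresponding nonhomogeneous cochain $(x_1,\dots,x_n)\mapsto\omega(x_1x_2\cdots x_n,x_2\cdots x_n,\dots,x_n,1)$ is bounded as a function of $x_1$ for each fixed $x_2,\dots,x_n$.) A 1-bounded representative of $a$ is a 1-bounded cocycle representing $a$. *)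

(* Defs.v *)
From HB Require Import structures.
From mathcomp Require Import all_boot all_order all_algebra.
From mathcomp Require Import generic_quotient ring_quotient all_classical all_reals.

Set Implicit Arguments.
Unset Strict Implicit.
Unset Printing Implicit Defensive.

Import Order.TTheory GRing.Theory Num.Theory.
Local Open Scope ring_scope.

Section StandardModel.
Variables (G : groupType) (R : realType).

(** The [n]-simplices of [EG]. *)
Definition simplex (n : nat) := n.+1.-tuple G.

Definition act_simplex n (s : simplex n) (g : G) : simplex n :=
  [tuple of [seq (x * g)%g | x <- s]].

Definition face n (i : 'I_n.+2) (s : simplex n.+1) : simplex n :=
  [tuple tnth s (lift i j) | j < n.+1].

(** [C^n(EG; R)], with the pointwise additive structure. *)
Definition cochain (n : nat) : Type := simplex n -> R.
HB.instance Definition _ n := GRing.Zmodule.on (cochain n).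

Definition delta n (w : cochain n) : cochain n.+1 :=
  fun s => \sum_(i < n.+2) (-1) ^+ i * w (face i s).

Definition act n (g : G) (w : cochain n) : cochain n :=
  fun s => w (act_simplex s g).

(** Cochains on [BG] are identified, via the quotient map [EG -> BG], with the
    invariant cochains on [EG]. *)
Definition invariant n (w : cochain n) : Prop := forall g, act g w = w.

Definition cocycle_pred n : {pred cochain n} :=
  fun w => `[< invariant w /\ delta w = 0 >].

Lemma deltaB n (u v : cochain n) : delta (u - v) = delta u - delta v.
Proof.
apply/funext => s; rewrite /delta [RHS]/GRing.add/= [X in _ + X]/GRing.opp/=.
rewrite -sumrB; apply: eq_bigr => i _.
by rewrite -mulrBr.
Qed.

Lemma delta0 n : delta (0 : cochain n) = 0.
Proof. by rewrite -[X in delta X](subrr 0) deltaB subrr. Qed.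

Lemma invariant0 n : invariant (0 : cochain n).
Proof. by []. Qed.

Lemma invariantB n (u v : cochain n) :
  invariant u -> invariant v -> invariant (u - v).
Proof. by move=> hu hv g; rewrite -[in RHS](hu g) -[in RHS](hv g). Qed.

Fact cocycle_zmod_closed n : zmod_closed (@cocycle_pred n).
Proof.
split=> [|u v /asboolP[iu du] /asboolP[iv dv]]; apply/asboolP.
  by split; [exact: invariant0|exact: delta0].
by split; [exact: invariantB|rewrite deltaB du dv subrr].
Qed.
HB.instance Definition _ n := GRing.isZmodClosed.Build (cochain n)
  (@cocycle_pred n) (@cocycle_zmod_closed n).

(** [Z^n(BG; R)] *)
Record cocycle (n : nat) := Cocycle {
  cocycle_val :> cochain n; _ : cocycle_val \in @cocycle_pred n }.
HB.instance Definition _ n := [isSub for @cocycle_val n].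
HB.instance Definition _ n := [Choice of cocycle n by <:].
HB.instance Definition _ n := [SubChoice_isSubZmodule of cocycle n by <:].

(** There are no cochains in degree [-1]; and in positive degree the primitive
    has to be a cochain on [BG], i.e. invariant. *)
Definition coboundary n : cochain n -> Prop :=
  match n with
  | 0 => fun w => w = 0
  | k.+1 => fun w => exists2 b : cochain k, invariant b & w = delta b
  end.

Definition coboundary_pred n : {pred cocycle n} :=
  fun c => `[< coboundary (c : cochain n) >].

Fact coboundary_zmod_closed n : zmod_closed (@coboundary_pred n).
Proof.
case: n => [|n].
  split=> [|u v /asboolP/= hu /asboolP/= hv]; apply/asboolP => //=.
  by rewrite hu hv subrr.
split=> [|u v /asboolP[b ib hu] /asboolP[d id hv]]; apply/asboolP.
  by exists 0; [exact: invariant0|rewrite delta0].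
by exists (b - d); [exact: invariantB|rewrite deltaB -hu -hv].
Qed.
HB.instance Definition _ n := GRing.isZmodClosed.Build (cocycle n)
  (@coboundary_pred n) (@coboundary_zmod_closed n).

(** [H^n(BG; R)] *)
Definition cohomology (n : nat) : Type := Quotient.quot (@coboundary_pred n).

Definition cohomology_class n (c : cocycle n) : cohomology n :=
  \pi_(Quotient.quot (@coboundary_pred n))%qT c.

Definition represents n (c : cocycle n) (a : cohomology n) : Prop :=
  cohomology_class c = a.

Definition tamed n (alpha nu : cochain n) : Prop :=
  forall (g : G) (s : simplex n), `|(act g alpha - alpha) s| <= nu s.

Definition hyperbolic_cocycle n (alpha : cocycle n.+1) : Prop :=
  exists beta : cochain n,
    (alpha : cochain n.+1) = delta beta /\
    exists2 nu : cochain n, invariant nu & tamed beta nu.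

Definition hyperbolic n (a : cohomology n.+1) : Prop :=
  exists2 alpha : cocycle n.+1, represents alpha a & hyperbolic_cocycle alpha.

Definition one_bounded n (w : cochain n.+1) : Prop :=
  exists2 lambda : cochain n, invariant lambda &
    forall (h : G) (s : simplex n),
      `|w [tuple of h :: s] - w [tuple of 1%g :: s]| < lambda s.

End StandardModel.

(* Main.v *)
Require Import Defs.
From mathcomp Require Import all_boot all_order all_algebra.
From mathcomp Require Import all_classical all_reals.
From mathcomp Require Import generic_quotient ring_quotient.

(** The bridge between the two notions is the cone operator
    [(cone h w) s = w (h, s)], a contracting homotopy of the cochain complex of
    [EG]: [cone h (delta w) = w - delta (cone h w)].  Translating by [h^-1]
    turns [w (h, s)] into [w (1, s h^-1)] for an invariant [w], so the variation
    of [w] in its first entry is the variation of [cone 1 w] along the orbit of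
    [s].  Hence an invariant [w] is 1-bounded exactly when [cone 1 w] is tamed by
    an invariant cochain ([one_bounded_cone]).

    If [w] is a 1-bounded cocycle, the homotopy identity gives
    [w = delta (cone 1 w)], so [w] itself is hyperbolic, with primitive
    [cone 1 w].

    Conversely, let [alpha = delta beta] with [beta] tamed by an invariant [nu].
    The invariant cochain [homogenize beta] agrees with [beta] on all simplices
    with first vertex [1], hence [theta = beta - homogenize beta] vanishes on
    these, and so [cone 1 (delta theta) = theta].  Subtracting an invariant
    cochain does not change the variation along orbits: [theta] is again tamed by
    [nu].  Therefore [delta theta = alpha - delta (homogenize beta)] is a
    1-bounded cocycle, and it is cohomologous to [alpha]. *)

Set Implicit Arguments.
Unset Strict Implicit.
Unset Printing Implicit Defensive.

Import Order.TTheory GRing.Theory Num.Theory.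
(* [invariant] is to mean invariance of a cochain, not [eqtype.invariant]. *)
Import Defs.
Local Open Scope ring_scope.

Section Cone.
Variables (G : groupType) (R : realType).
Implicit Types (n : nat) (g h : G).

Definition cone n h (w : cochain G R n.+1) : cochain G R n :=
  fun s => w [tuple of h :: s].

Lemma act_simplexM n (s : simplex G n) g h :
  act_simplex (act_simplex s g) h = act_simplex s (g * h)%g.
Proof.
apply: val_inj => /=; rewrite -map_comp.
by apply: eq_map => x /=; rewrite mulgA.
Qed.

Lemma act_simplex_cons n (s : simplex G n) g h :
  act_simplex [tuple of h :: s] g = [tuple of (h * g)%g :: act_simplex s g].
Proof. exact: val_inj. Qed.

Lemma thead_act_simplex n (s : simplex G n) g :
  thead (act_simplex s g) = (thead s * g)%g.
Proof. by rewrite /thead tnth_map. Qed.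

Lemma face_act_simplex n (s : simplex G n.+1) (i : 'I_n.+2) g :
  face i (act_simplex s g) = act_simplex (face i s) g.
Proof. by apply: eq_from_tnth => j; rewrite !(tnth_mktuple, tnth_map). Qed.

Lemma face0_cons n (s : simplex G n) h :
  face ord0 [tuple of h :: s] = s.
Proof. by apply: eq_from_tnth => j; rewrite tnth_mktuple tnthS. Qed.

Lemma thead_face_lift0 n (s : simplex G n.+1) (i : 'I_n.+1) :
  thead (face (lift ord0 i) s) = thead s.
Proof. by rewrite /thead tnth_mktuple; congr tnth; apply: val_inj. Qed.

Lemma face_lift0_cons n (s : simplex G n.+1) (i : 'I_n.+2) h :
  face (lift ord0 i) [tuple of h :: s] = [tuple of h :: face i s].
Proof.
apply: eq_from_tnth => j; rewrite tnth_mktuple.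
case: (unliftP ord0 j) => [k|] ->; last first.
  by rewrite tnth0 -[X in tnth _ X](_ : ord0 = _) ?tnth0 //; apply: val_inj.
rewrite tnthS tnth_mktuple -[RHS](tnthS h); congr tnth.
by apply: val_inj; rewrite /= /bump /= !add1n ltnS addnS.
Qed.

Lemma delta_cons n (w : cochain G R n) (s : simplex G n) h :
  delta w [tuple of h :: s] = w s -
    \sum_(i < n.+1) (-1) ^+ i * w (face (lift ord0 i) [tuple of h :: s]).
Proof.
rewrite /delta big_ord_recl face0_cons expr0 mul1r -sumrN; congr (_ + _).
by apply: eq_bigr => i _; rewrite lift0 exprS mulN1r mulNr.
Qed.

(** Deleting [h] from [(h, s)] returns [s]; deleting a vertex of [s] commutes
    with prepending [h], at the price of a sign. *)
Lemma cone_delta n h (w : cochain G R n.+1) :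
  cone h (delta w) = w - delta (cone h w).
Proof.
apply/funext => s; rewrite /cone delta_cons; congr (_ - _).
by apply: eq_bigr => i _; rewrite face_lift0_cons.
Qed.

(** Every face of [(h, s)] other than [s] still starts with [h].  Unlike the
    homotopy identity, this covers degree 0 as well. *)
Lemma cone_delta_vanishing n h (w : cochain G R n) :
  (forall s, thead s = h -> w s = 0) -> cone h (delta w) = w.
Proof.
move=> w0; apply/funext => s; rewrite /cone delta_cons big1 ?subr0 // => i _.
by rewrite w0 ?mulr0 // thead_face_lift0.
Qed.

Lemma eq_cone n (u v : cochain G R n.+1) :
  (forall h, cone h u = cone h v) -> u = v.
Proof.
move=> uv; apply/funext => s; rewrite (tuple_eta s).
exact: (congr1 (fun w => w [tuple of behead s]) (uv (thead s))).
Qed.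

Lemma delta_cst0 (c : R) : delta ((fun=> c) : cochain G R 0) = 0.
Proof.
apply/funext => s.
by rewrite /delta !big_ord_recl big_ord0 /= expr0 expr1 mul1r mulN1r addr0 subrr.
Qed.

(** In positive degree, applying the homotopy identity twice shows that [cone h]
    carries [delta (delta w)] to [delta (delta (cone h w))], so induction on the
    degree replaces the usual pairing of the faces of faces.  In degree 0 the
    constant [w (h)] takes the place of [delta (cone h w)]. *)
Lemma deltaK n (w : cochain G R n) : delta (delta w) = 0.
Proof.
elim: n w => [|n IHn] w; apply: eq_cone => h; rewrite cone_delta.
  rewrite (_ : cone h (delta w) = w - (fun=> w [tuple h])).
    by rewrite deltaB delta_cst0 subr0 subrr.
  apply/funext => s; rewrite /cone delta_cons big_ord1 expr0 mul1r.
  congr (_ - w _).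
  apply: eq_from_tnth => j.
  by rewrite (ord1 j) -[LHS]/(thead _) thead_face_lift0.
by rewrite cone_delta deltaB IHn subr0 subrr.
Qed.

Lemma delta_act n g (w : cochain G R n) : delta (act g w) = act g (delta w).
Proof.
by apply/funext => s; apply: eq_bigr => i _; rewrite /act face_act_simplex.
Qed.

Lemma invariant_delta n (w : cochain G R n) : invariant w -> invariant (delta w).
Proof. by move=> iw g; rewrite -delta_act iw. Qed.

Lemma invariant_cons n (w : cochain G R n.+1) (s : simplex G n) h :
  invariant w -> w [tuple of h :: s] = cone 1%g w (act_simplex s h^-1%g).
Proof. by move=> iw; rewrite -{1}(iw h^-1%g) /act act_simplex_cons mulgV. Qed.

(** For invariant [w], moving the first entry of [w (h, s)] amounts to moving [s]
    along its orbit under [cone 1 w]. *)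
Lemma one_bounded_cone n (w : cochain G R n.+1) : invariant w ->
  one_bounded w <-> exists2 nu, invariant nu & tamed (cone 1%g w) nu.
Proof.
move=> iw; split=> [[l il wl]|[nu inu wnu]].
  exists l => // g s; apply: ltW.
  by have := wl g^-1%g s; rewrite invariant_cons // invgK.
(* 1-boundedness is a strict inequality and tameness a weak one. *)
exists (fun s => nu s + 1) => [g|h s].
  by apply/funext => s; rewrite -[in RHS](inu g).
rewrite invariant_cons //; apply: le_lt_trans (wnu h^-1%g s) _.
by rewrite ltrDl ltr01.
Qed.

(** Translating the first vertex to [1] picks one representative in each orbit
    of simplices. *)
Definition homogenize n (w : cochain G R n) : cochain G R n :=
  fun s => w (act_simplex s (thead s)^-1%g).

Lemma invariant_homogenize n (w : cochain G R n) : invariant (homogenize w).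
Proof.
move=> g; apply/funext => s.
by rewrite /act /homogenize act_simplexM thead_act_simplex invgM mulgA mulgV mul1g.
Qed.

Lemma homogenize_thead1 n (w : cochain G R n) (s : simplex G n) :
  thead s = 1%g -> homogenize w s = w s.
Proof.
move=> s1; rewrite /homogenize s1 invg1; congr w.
by apply: val_inj; rewrite /= -[RHS]map_id; apply: eq_map => x; rewrite mulg1.
Qed.

(** [act g (w - u) - (w - u)] and [act g w - w] are the same cochain. *)
Lemma tamedB_invariant n (w u nu : cochain G R n) :
  invariant u -> tamed w nu -> tamed (w - u) nu.
Proof.
move=> iu wnu g s; have /(congr1 (@^~ s)) us := iu g.
apply: le_trans (wnu g s); rewrite le_eqVlt; apply/orP; left; apply/eqP.
congr `|_|; rewrite -[LHS]/(act g w s - act g u s - (w s - u s)) us.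
by rewrite opprB addrA subrK.
Qed.

Lemma cocycleP n (c : cocycle G R n) :
  invariant (c : cochain G R n) /\ delta (c : cochain G R n) = 0.
Proof. exact/asboolP/(valP c). Qed.

Lemma cohomology_class_eq n (c d : cocycle G R n) :
  coboundary (c - d : cochain G R n) -> cohomology_class c = cohomology_class d.
Proof.
by move=> cd; apply/eqP; rewrite -[_ == _]Quotient.idealrBE; apply/asboolP.
Qed.

Lemma one_bounded_hyperbolic n (w : cocycle G R n.+1) :
  one_bounded w -> hyperbolic_cocycle w.
Proof.
have [iw dw] := cocycleP w; move=> /(one_bounded_cone iw) tw.
exists (cone 1%g w); split=> //; apply/eqP; rewrite -subr_eq0 -cone_delta dw.
exact/eqP.
Qed.

Lemma hyperbolic_one_bounded n (alpha : cocycle G R n.+1) :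
  hyperbolic_cocycle alpha ->
  exists2 w : cocycle G R n.+1,
    cohomology_class w = cohomology_class alpha & one_bounded w.
Proof.
move=> [b [ab [nu inu bnu]]]; have [ia _] := cocycleP alpha.
pose eta := homogenize b; have ieta : invariant eta := invariant_homogenize b.
have ithe : invariant (delta (b - eta)).
  by rewrite deltaB -ab; apply: invariantB => //; exact: invariant_delta.
have cthe : delta (b - eta) \in @cocycle_pred G R n.+1.
  by apply/asboolP; split=> //; exact: deltaK.
exists (Cocycle cthe).
  apply: cohomology_class_eq; exists (- eta).
    by rewrite -sub0r; apply: invariantB.
  by rewrite /= ab -deltaB addrAC subrr add0r.
apply/one_bounded_cone => //; exists nu => //=.
rewrite cone_delta_vanishing; first exact: tamedB_invariant.
by move=> s s1; rewrite -[LHS]/(b s - eta s) /eta homogenize_thead1 // subrr.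
Qed.

End Cone.

Theorem corollary5p6 (G : groupType) (R : realType) (n : nat)
    (a : cohomology G R n.+1) :
  hyperbolic a <->
  exists2 omega : cocycle G R n.+1, represents omega a & one_bounded omega.
Proof.
split=> [[alpha <- /hyperbolic_one_bounded//]|[w wa /one_bounded_hyperbolic hw]].
by exists w.
Qed.
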